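(* For every connected cograph $G$ of order $n\geq 1$, $$\frac{n}{2}< M_G\leq \frac{n+1}{2},$$ with equality in the upper bound if and only if $n=1$. Consequently, if $(G_i)_{i\ge 1}$ is any infinite sequence of distinct (pairwise non-isomorphic) connected cographs, and $n_i$ is the order of $G_i$, then the densities $M_{G_i}/n_i$ tend to $\tfrac12$ as $i\to\infty$.
   Context: All graphs are finite and simple with at least one vertex; the order of a graph is its number of vertices. A graph is a cograph if it contains no induced path on $4$ vertices. For a graph $G$ of order $n$, let $a_k(G)$ be the number of $k$-element vertex subsets of $G$ that induce a connected subgraph (single vertices count as connected), and let $\Phi_G(x)=\sum_{k=1}^n a_k(G)x^k$. The global mean of $G$ is $M_G=\Phi_G'(1)/\Phi_G(1)$, and the density of $G$ is $M_G/n$. *)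

(* Defs.v *)
From HB Require Import structures.
From mathcomp Require Import all_boot all_order all_algebra.

Set Implicit Arguments.
Unset Strict Implicit.
Unset Printing Implicit Defensive.

Import GRing.Theory.

(* Finite simple graphs with at least one vertex. *)
Record sgraph := SGraph {
  vertex :> finType;
  adj : rel vertex;
  adj_sym : symmetric adj;
  adj_irrefl : irreflexive adj;
  vertex_gt0 : 0 < #|vertex|
}.

Definition graph_order (G : sgraph) : nat := #|vertex G|.

Definition induced_subgraph (H G : sgraph) : Prop :=
  exists f : H -> G, injective f /\ forall x y : H, adj (f x) (f y) = adj x y.

Definition isomorphic (G H : sgraph) : Prop :=
  exists f : G -> H, bijective f /\ forall x y : G, adj (f x) (f y) = adj x y.

Definition P4_adj : rel 'I_4 :=
  fun i j => (i.+1 == j :> nat) || (j.+1 == i :> nat).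

Lemma P4_adj_sym : symmetric P4_adj.
Proof. by move=> i j; rewrite /P4_adj orbC. Qed.

Lemma P4_adj_irrefl : irreflexive P4_adj.
Proof. by move=> i; rewrite /P4_adj orbb gtn_eqF. Qed.

Lemma P4_vertex_gt0 : 0 < #|'I_4|.
Proof. by rewrite card_ord. Qed.

Definition P4 : sgraph := SGraph P4_adj_sym P4_adj_irrefl P4_vertex_gt0.

Definition cograph (G : sgraph) : Prop := ~ induced_subgraph P4 G.

(* Adjacency in the subgraph induced by S, as a relation on all of G. *)
Definition induced_adj (G : sgraph) (S : {set G}) : rel G :=
  fun x y => [&& x \in S, y \in S & adj x y].

Definition induces_connected (G : sgraph) (S : {set G}) : bool :=
  (S != set0) &&
  [forall x in S, forall y in S, connect (induced_adj S) x y].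

Definition graph_connected (G : sgraph) : bool :=
  [forall x : G, forall y : G, connect (@adj G) x y].

Definition num_connected (G : sgraph) (k : nat) : nat :=
  #|[set S : {set G} | (#|S| == k) && induces_connected S]|.

Local Open Scope ring_scope.

Definition connected_poly (R : nzRingType) (G : sgraph) : {poly R} :=
  \sum_(1 <= k < (graph_order G).+1) (num_connected G k)%:R *: 'X^k.

Definition global_mean (R : fieldType) (G : sgraph) : R :=
  (connected_poly R G)^`().[1] / (connected_poly R G).[1].

Definition density (R : fieldType) (G : sgraph) : R :=
  global_mean R G / (graph_order G)%:R.

(* Main.v *)
Require Import Defs.
From mathcomp Require Import all_boot all_order all_algebra.
From mathcomp Require Import zify ring lra.

Set Implicit Arguments.
Unset Strict Implicit.
Unset Printing Implicit Defensive.

Import Order.TTheory GRing.Theory Num.Theory.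

(** A P4-free graph on at least two vertices is a join or a disjoint union of
    two smaller graphs, so everything is an induction along cotrees. For a
    cograph H of order n with N connected sets of total size W, put
    D = 2 W - n N and c = 2^n - 1 - N. For a join of H1 and H2, of orders a
    and b, D = D1 + b c1 + D2 + a c2; for a disjoint union
    D = D1 - b N1 + D2 - a N2, which may be negative. The lower bound D > 0 for
    joins thus needs D + c >= 1 for all cographs, connected or not, and this
    invariant passes through disjoint unions with the help of D + 2 c >= n.
    The upper bound comes from the invariant D <= N.
    For the densities, only finitely many isomorphism classes have order at
    most K, so the orders in the sequence tend to infinity. *)

(** * Arithmetic of the invariants under union and join *)

Section MeanBounds.
Local Open Scope ring_scope.
Variable Z : realDomainType.

(* n is the order, N the number of connected sets, W the sum of their sizes
   and P = 2^n, so that P - 1 - N counts the nonempty disconnected sets. *)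
Record mean_bounds (n N W P : Z) : Prop := MeanBounds {
  mb_n1 : 1 <= n;
  mb_nP : 2 * n <= P;
  mb_nN : n <= N;
  mb_NP : N <= P - 1;
  mb_D2c : n <= (2 * W - n * N) + 2 * (P - 1 - N);
  mb_Dc : 1 <= (2 * W - n * N) + (P - 1 - N);
  mb_DN : 2 * W - n * N <= N
}.

Lemma mean_bounds1 : mean_bounds 1 1 1 2.
Proof. by split; lra. Qed.

(** Here c = c1 + c2 + (P1 - 1)(P2 - 1). The bounds D1 + 2 c1 >= a and D2 + 2 c2 >= b give D + c >=
    (P1 - 1 - a)(P2 - 1 - b) + a + b - a b. By [mb_nP] the product is at least (a - 1)(b - 1), so
    the total is at least 1. *)
Lemma mean_bounds_union a N1 W1 P1 b N2 W2 P2 :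
  mean_bounds a N1 W1 P1 -> mean_bounds b N2 W2 P2 ->
  mean_bounds (a + b) (N1 + N2) (W1 + W2) (P1 * P2).
Proof.
move=> [a1 aP aN NP1 Q1 V1 U1] [b1 bP bN NP2 Q2 V2 U2].
(* [lra] treats monomials as atoms, so the products of nonnegative factors are supplied by hand. *)
have h1 : 0 <= b * (P1 - 1 - N1) by apply: mulr_ge0; lra.
have h2 : 0 <= a * (P2 - 1 - N2) by apply: mulr_ge0; lra.
have h3 : 0 <= (b - 1) * (P1 - 1 - N1) by apply: mulr_ge0; lra.
have h4 : 0 <= (a - 1) * (P2 - 1 - N2) by apply: mulr_ge0; lra.
have h5 : 0 <= (P1 - 2 * a) * (P2 - 2 * b) by apply: mulr_ge0; lra.
have h6 : 0 <= (P1 - 2 * a) * (b - 1) by apply: mulr_ge0; lra.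
have h7 : 0 <= (a - 1) * (P2 - 2 * b) by apply: mulr_ge0; lra.
have h8 : 0 <= (P1 - 1) * (P2 - 1 - b) by apply: mulr_ge0; lra.
have h9 : 0 <= (P2 - 1) * (P1 - 1 - a) by apply: mulr_ge0; lra.
have h10 : 0 <= (b - 1) * N1 by apply: mulr_ge0; lra.
have h11 : 0 <= (a - 1) * N2 by apply: mulr_ge0; lra.
have h12 : 0 <= (P1 - 2) * (P2 - 2) by apply: mulr_ge0; lra.
by split; lra.
Qed.

(** A set meeting both sides is connected, so c = c1 + c2, and D >= (D1 + c1) + (D2 + c2) >= 2. From
    [mb_DN] and [mb_nN] on both sides, N - D >= (P1 - 1 - a)(P2 - 1 - b) + a b > 0. *)
Lemma mean_bounds_join a N1 W1 P1 b N2 W2 P2 N W :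
  mean_bounds a N1 W1 P1 -> mean_bounds b N2 W2 P2 ->
  N + (P1 + P2) = N1 + N2 + (P1 * P2 + 1) ->
  2 * W + (a * P1 + b * P2) = 2 * (W1 + W2) + (a + b) * (P1 * P2) ->
  [/\ mean_bounds (a + b) N W (P1 * P2),
      0 < 2 * W - (a + b) * N & 2 * W - (a + b) * N < N].
Proof.
move=> [a1 aP aN NP1 Q1 V1 U1] [b1 bP bN NP2 Q2 V2 U2] NE WE.
have {}NE : N = N1 + N2 + (P1 - 1) * (P2 - 1) by lra.
have DE : 2 * W - (a + b) * N = (2 * W1 - a * N1) + b * (P1 - 1 - N1)
    + ((2 * W2 - b * N2) + a * (P2 - 1 - N2)).
  have -> : 2 * W = 2 * (W1 + W2) + (a + b) * (P1 * P2) - (a * P1 + b * P2).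
    by rewrite -WE; ring.
  by rewrite NE; ring.
have h3 : 0 <= (b - 1) * (P1 - 1 - N1) by apply: mulr_ge0; lra.
have h4 : 0 <= (a - 1) * (P2 - 1 - N2) by apply: mulr_ge0; lra.
have h5 : 0 <= (P1 - 1 - a) * (P2 - 1 - b) by apply: mulr_ge0; lra.
have h6 : 0 < a * b by apply: mulr_gt0; lra.
have h7 : 0 <= b * (N1 - a) by apply: mulr_ge0; lra.
have h8 : 0 <= a * (N2 - b) by apply: mulr_ge0; lra.
have h9 : 0 <= (P1 - 2) * (P2 - 2) by apply: mulr_ge0; lra.
have DN : 2 * W - (a + b) * N < N by rewrite DE NE; lra.
split=> //; last by rewrite DE; lra.
by split; rewrite ?DE ?NE; try lra; exact: ltW DN.
Qed.

End MeanBounds.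

(** * Splitting P4-free relations *)

Section Splitting.
Local Open Scope nat_scope.
Variable T : finType.
Implicit Types (r : rel T) (A B C S : {set T}).

Definition negrel r : rel T := fun x y => ~~ r x y.

Definition P4_free r := forall a b c d : T, uniq [:: a; b; c; d] ->
  r a b -> r b c -> r c d -> ~~ r a c -> ~~ r a d -> ~~ r b d -> False.

(** For an adjacency relation this is a join; for its [negrel], a disjoint union. *)
Definition splits r A B C := [/\ B != set0, C != set0,
  A = B :|: C, [disjoint B & C] & {in B & C, forall x y, r x y}].

Lemma negrel_sym r : symmetric r -> symmetric (negrel r).
Proof. by move=> r_sym x y; rewrite /negrel r_sym. Qed.

(* P4 is self-complementary: the complement of a - b - c - d is c - a - d - b. *)
Lemma negrel_P4_free r : symmetric r -> P4_free r -> P4_free (negrel r).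
Proof.
rewrite /negrel => r_sym r_free a b c d uniq_abcd ab bc cd.
rewrite !negbK => ac ad bd; apply: (r_free c a d b) => //; rewrite 1?r_sym //.
by move: uniq_abcd; rewrite /= !inE !negb_or !andbT (eq_sym c a) (eq_sym c d)
  (eq_sym c b) (eq_sym d b) => /andP[/and3P[-> -> ->] /andP[/andP[-> ->] ->]].
Qed.

Lemma splitsC r A B C : symmetric r -> splits r A B C -> splits r A C B.
Proof.
move=> r_sym [B0 C0 -> dBC BC]; split; rewrite // 1?setUC //.
  by rewrite disjoint_sym.
by move=> x y xC yB; rewrite r_sym BC.
Qed.

(* With x, y in B adjacent, x but not y a neighbour of v, and z in C a
   neighbour of v, the path z - v - x - y would be induced. *)
Lemma splits_extend_nonneighbour r A B C v y : symmetric r ->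
  P4_free r -> v \in A -> splits (negrel r) (A :\ v) B C ->
  y \in B -> ~~ r v y -> exists B' C', splits (negrel r) A B' C'.
Proof.
move=> r_sym r_free vA [B0 C0 ABC dBC BC] yB vy.
have vNBC : v \notin B :|: C by rewrite -ABC !inE eqxx.
have AE : A = v |: (B :|: C) by rewrite -ABC setD1K.
have [/existsP[z /andP[zC vz]]|noz] := boolP [exists z, (z \in C) && r v z]; last first.
  (* [v] has no neighbour in [C], so it can be added to the side [B]. *)
  exists C, (v |: B); split=> //.
  - by apply/set0Pn; exists v; rewrite !inE eqxx.
  - by rewrite AE [RHS]setUCA (setUC C).
  - rewrite disjoint_sym disjoints_subset; apply/subsetP => x.
    rewrite !inE => /predU1P[->|xB]; last by rewrite (disjointFr dBC).
    by move: vNBC; rewrite inE negb_or => /andP[].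
  - move=> x w xC; rewrite !inE => /predU1P[->|wB].
      by move: noz; rewrite negb_exists /negrel r_sym => /forallP/(_ x); rewrite xC.
    by rewrite (negrel_sym r_sym) BC.
(* The nonneighbours of [v] in [B] have no edge to [v] or to [C]; the forbidden path rules out edges
   to the rest of [B]. *)
pose B1 := [set x in B | ~~ r v x].
have B1B x : x \in B1 -> x \in B by rewrite inE => /andP[].
exists B1, (A :\: B1); split.
- by apply/set0Pn; exists y; rewrite inE yB.
- apply/set0Pn; exists v; rewrite !inE vA andbT; apply/nandP; left.
  by move: vNBC; rewrite inE negb_or => /andP[].
- apply/setP => x; rewrite !inE; case: (boolP (_ && _)) => //= /andP[xB _].
  by rewrite AE !inE xB orbT.
- by rewrite disjoints_subset; apply/subsetP => x; rewrite !inE => /andP[-> ->].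
move=> y' x; rewrite !inE => /andP[y'B vy'] /andP[xnB1].
rewrite AE !inE => /or3P[/eqP->|xB|xC].
- by rewrite /negrel r_sym.
- move: xnB1; rewrite xB /= negbK => vx.
  apply/negP => y'x.
  have nzB w : w \in B -> z != w.
    by move=> wB; apply: contraTneq wB => <-; rewrite (disjointFl dBC).
  have rzB w : w \in B -> ~~ r z w by move=> wB; rewrite r_sym; apply: BC.
  have neqv w : w \in B :|: C -> v != w by apply: contraTneq => <-.
  apply: (r_free z v x y'); rewrite ?rzB // 1?r_sym //.
  rewrite /= !inE !negb_or (eq_sym z v) !neqv ?inE ?xB ?y'B ?zC ?orbT // !nzB //=.
  by rewrite andbT; apply: contraNneq vy' => <-.
- exact: BC.
Qed.

(** If [v] is adjacent to all other vertices, it forms one side of a join. Otherwise a nonneighbour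
    lies in [B] or [C], whose roles are symmetric. *)
Lemma splits_extend r A B C v : symmetric r ->
  P4_free r -> v \in A -> splits (negrel r) (A :\ v) B C ->
  exists B' C', splits (negrel r) A B' C' \/ splits r A B' C'.
Proof.
move=> r_sym r_free vA sBC.
have [/existsP[y /andP[yA vy]]|ally] := boolP [exists y, (y \in A :\ v) && ~~ r v y].
  have [B' [C' sBC']] : exists B' C', splits (negrel r) A B' C'; last by exists B', C'; left.
  case: (sBC) => _ _ ABC _ _; move: yA; rewrite ABC inE => /orP[yB|yC].
    exact: splits_extend_nonneighbour sBC yB vy.
  exact: splits_extend_nonneighbour (splitsC (negrel_sym r_sym) sBC) yC vy.
exists [set v], (A :\ v); right; split.
- by apply/set0Pn; exists v; rewrite inE.
- case: sBC => /set0Pn[x xB] _ -> _ _.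
  by apply/set0Pn; exists x; rewrite inE xB.
- by rewrite setD1K.
- by rewrite disjoints1 !inE eqxx.
move=> x y; rewrite inE => /eqP-> yA.
by move: ally; rewrite negb_exists => /forallP/(_ y); rewrite yA /= negbK.
Qed.

(** Seinsche's theorem: delete a vertex, split the rest by induction, and extend the split. *)
Lemma P4_free_splits r A : symmetric r -> P4_free r -> 1 < #|A| ->
  exists B C, splits (negrel r) A B C \/ splits r A B C.
Proof.
move=> r_sym r_free; have [n] := ubnP #|A|; elim: n A => // n IHn A leAn A_gt1.
have /card_gt0P[v vA] := ltnW A_gt1.
have cardA : #|A| = #|A :\ v|.+1 by rewrite (cardsD1 v) vA.
have [Av_gt1|] := ltnP 1 #|A :\ v|.
  have [||B [C [sBC|sBC]]] := IHn (A :\ v) => //; first by rewrite -ltnS -cardA.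
    exact: splits_extend sBC.
  (* A join is a disjoint union in the complement, which is P4-free too, so the same extension
     applies there. *)
  have sBC' : splits (negrel (negrel r)) (A :\ v) B C.
    by case: sBC => B0 C0 ABC dBC BC; split=> // x y xB yC; rewrite /negrel negbK BC.
  have [|B' [C' [[B0 C0 ABC dBC BC]|sBC'']]] :=
      splits_extend (negrel_sym r_sym) _ vA sBC'; first exact: negrel_P4_free.
    exists B', C'; right; split=> // x y xB yC.
    by move: (BC _ _ xB yC); rewrite /negrel negbK.
  by exists B', C'; left.
rewrite leq_eqVlt ltnS leqn0 => /orP[/cards1P[w Aw]|]; last first.
  by rewrite cards_eq0 -cards_eq0 => Av0; rewrite cardA (eqP Av0) in A_gt1.
have vw : v != w by have := set11 w; rewrite -Aw !inE eq_sym => /andP[].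
(* With two vertices, their adjacency decides the kind of split. *)
exists [set v], [set w].
have AE : A = [set v] :|: [set w] by rewrite -Aw setD1K.
have [rvw|nrvw] := boolP (r v w); [right|left]; split; rewrite // ?disjoints1 ?inE //.
all: try by apply/set0Pn; eexists; rewrite inE.
all: by move=> x y; rewrite !inE => /eqP-> /eqP->.
Qed.

End Splitting.

(** * Connected sets of joins and disjoint unions *)

Section ConnectedSets.
Local Open Scope nat_scope.
Variable G : sgraph.
Implicit Types A B C S : {set G}.

Lemma cograph_P4_free : cograph G -> P4_free (@adj G).
Proof.
move=> coG a b c d uniq_abcd ab bc cd nac nad nbd; apply: coG.
exists (fun i : 'I_4 => nth a [:: a; b; c; d] i); split.
  move=> i j eq_ij; apply/val_inj/eqP.
  by rewrite -(nth_uniq a _ _ uniq_abcd) ?ltn_ord // eq_ij.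
move=> [[|[|[|[|i]]]] // lti] [[|[|[|[|j]]]] // ltj] /=;
  rewrite /P4_adj /= ?adj_irrefl //; do ?exact: negbTE.
all: by rewrite adj_sym //; apply: negbTE.
Qed.

Lemma induced_adj_connect_sym S : connect_sym (induced_adj S).
Proof.
by apply: sym_connect_sym => x y; rewrite /induced_adj andbCA adj_sym.
Qed.

Lemma induces_connected_neq0 S : induces_connected S -> S != set0.
Proof. by case/andP. Qed.

Lemma induces_connected1 (x : G) : induces_connected [set x].
Proof.
apply/andP; split; first by apply/set0Pn; exists x; rewrite inE.
by do 2![apply/'forall_implyP => ?; rewrite inE => /eqP->].
Qed.

Lemma induces_connectedT : graph_connected G -> induces_connected [set: G].
Proof.
move=> /'forall_forallP conG; apply/andP; split.
  by rewrite -card_gt0 cardsT vertex_gt0.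
apply/'forall_implyP => x _; apply/'forall_implyP => y _.
rewrite (@eq_connect _ _ (@adj G)) // => u v.
by rewrite /induced_adj !inE.
Qed.

(** Pick [b] in [B] and [c] in [C], both in [S]: vertices of [S] in [C] are adjacent to [b], and
    those in [B] reach [b] through [c]. *)
Lemma induces_connected_join A B C S : splits (@adj G) A B C ->
  S \subset A -> ~~ (S \subset B) -> ~~ (S \subset C) -> induces_connected S.
Proof.
move=> [_ _ AE _ BC] SA /subsetPn[c cS cB] /subsetPn[b bS bC].
have inBC x : x \in S -> x \in B :|: C by rewrite -AE; apply: (subsetP SA).
have {}cB : c \in C by have := inBC c cS; rewrite inE (negbTE cB).
have {}bC : b \in B by have := inBC b bS; rewrite inE (negbTE bC) orbF.
have conn_b x : x \in S -> connect (induced_adj S) x b.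
  move=> xS; have := inBC x xS; rewrite inE => /orP[xB|xC]; last first.
    by apply: connect1; rewrite /induced_adj xS bS adj_sym BC.
  apply: (@connect_trans _ _ c); apply: connect1.
    by rewrite /induced_adj xS cS BC.
  by rewrite /induced_adj bS cS adj_sym BC.
apply/andP; split; first by apply/set0Pn; exists b.
apply/'forall_implyP => x xS; apply/'forall_implyP => y yS.
by rewrite (connect_trans (conn_b x xS)) // induced_adj_connect_sym conn_b.
Qed.

(** [B] is closed under adjacency within [S], so no path leads from [B] to a vertex of [S] outside
    it. *)
Lemma induces_connected_union A B C S : splits (negrel (@adj G)) A B C ->
  S \subset A -> induces_connected S -> (S \subset B) || (S \subset C).
Proof.
move=> [_ _ AE _ BC] SA /andP[_ /'forall_implyP conS].
apply/norP => -[/subsetPn[c cS cB] /subsetPn[b bS bC]].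
have inBC x : x \in S -> x \in B :|: C by rewrite -AE; apply: (subsetP SA).
have {}bC : b \in B by have := inBC b bS; rewrite inE (negbTE bC) orbF.
have clB : closed (induced_adj S) B.
  apply: (intro_closed (induced_adj_connect_sym S)) => x y /and3P[xS yS xy] xB.
  apply: contraLR xy => yB; apply: BC => //.
  by have := inBC y yS; rewrite inE (negbTE yB).
have /'forall_implyP/(_ c cS) bc := conS b bS.
by rewrite -(closed_connect clB bc) bC in cB.
Qed.

Definition conn_sets A := [set S : {set G} | (S \subset A) && induces_connected S].

Lemma splits_subset r A B C S : splits r A B C ->
  [/\ S \subset B -> S \subset A, S \subset C -> S \subset A &
      (S \subset B) && (S \subset C) = (S == set0)].
Proof.
move=> [_ _ -> dBC _]; split=> [SB|SC|].
- exact: subset_trans SB (subsetUl _ _).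
- exact: subset_trans SC (subsetUr _ _).
- by rewrite -subsetI -subset0; move: dBC; rewrite -setI_eq0 => /eqP->.
Qed.

(** The weight [F] is kept general to cover both the number of sets and their total size. *)
Lemma sum_conn_sets_union (F : {set G} -> nat) A B C :
  splits (negrel (@adj G)) A B C ->
  \sum_(S in conn_sets A) F S =
    \sum_(S in conn_sets B) F S + \sum_(S in conn_sets C) F S.
Proof.
move=> sBC; rewrite ![\sum_(S in _) _]big_mkcond -big_split /=.
apply: eq_bigr => S _; rewrite !inE.
have [conS|] := boolP (induces_connected S); rewrite ?andbF ?andbT //.
have [SBA SCA] := splits_subset S sBC.
rewrite (negbTE (induces_connected_neq0 conS)).
have := @induces_connected_union _ _ _ S sBC ^~ conS.
case: (S \subset B) SBA => [/(_ isT)->|_]; first by case: (S \subset C); rewrite ?addn0.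
case: (S \subset C) SCA => [/(_ isT)->|_] //=.
by case: (S \subset A) => // /(_ isT).
Qed.

(** Besides the connected sets of either side, exactly the sets meeting both sides count. These are
    the subsets of [A] less those of [B] and of [C], with [set0] removed twice; hence the term
    [F set0] in this subtraction-free form. *)
Lemma sum_conn_sets_join (F : {set G} -> nat) A B C :
  splits (@adj G) A B C ->
  \sum_(S in conn_sets A) F S
    + (\sum_(S in powerset B) F S + \sum_(S in powerset C) F S) =
  \sum_(S in conn_sets B) F S + \sum_(S in conn_sets C) F S
    + (\sum_(S in powerset A) F S + F set0).
Proof.
(* As a sum over one set, [F set0] joins the other sums and the identity is checked set by set. *)
move=> sBC; rewrite -[F set0](big_set1 addn set0 F).
rewrite ![\sum_(S in _) _]big_mkcond -!big_split /=.
apply: eq_bigr => S _; rewrite !inE.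
have [SBA SCA] := splits_subset S sBC.
have := @induces_connected_neq0 S.
have := @induces_connected_join _ _ _ S sBC.
case: (S == set0); first move=> _ nconS.
  have {nconS}/negbTE-> : ~~ induces_connected S by apply/negP => /nconS.
  rewrite !andbF => /andP[SB SC].
  by rewrite SB SC SBA.
case: (S \subset B) SBA => [/(_ isT)->|_].
  case: (S \subset C) => // _ _ _.
  by case: (induces_connected S); rewrite /= !addn0.
case: (S \subset C) SCA => [/(_ isT)->|_].
  by case: (induces_connected S); rewrite /= ?addn0.
by case: (S \subset A) => // /(_ isT isT isT)->.
Qed.

(** Pair each subset with its complement in [A]: the two sizes add up to [#|A|]. *)
Lemma sum_powerset_card A : 2 * \sum_(S in powerset A) #|S| = #|A| * 2 ^ #|A|.
Proof.
rewrite mul2n -addnn {2}(reindex_onto (fun S => A :\: S) (fun S => A :\: S)) /=; last first.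
  by move=> S; rewrite powersetE setDDr setDv set0U => /setIidPr.
rewrite [X in _ + X](eq_bigl (mem (powerset A))); last first.
  move=> S; rewrite /= !powersetE subsetDl setDDr setDv set0U /=.
  by rewrite (sameP eqP setIidPr).
rewrite -big_split /= (eq_bigr (fun=> #|A|)) ?sum_nat_const ?card_powerset 1?mulnC //.
move=> S; rewrite powersetE => SA.
by rewrite -(cardsID S A) (setIidPr SA).
Qed.

End ConnectedSets.

(** * Bounds for cographs and the values of the polynomial at 1 *)

Section CographMean.
Local Open Scope nat_scope.
Variable G : sgraph.
Implicit Types A B C S : {set G}.

Definition nconn A := \sum_(S in conn_sets A) 1.
Definition wconn A := \sum_(S in conn_sets A) #|S|.

Definition set_mean_bounds A :=
  @mean_bounds int #|A|%:Z (nconn A)%:Z (wconn A)%:Z (2 ^ #|A|)%:Z.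

Lemma sum_conn_sets1 (F : {set G} -> nat) x :
  \sum_(S in conn_sets [set x]) F S = F [set x].
Proof.
rewrite (big_pred1 [set x]) // => S; rewrite !inE subset1 /=.
apply/andP/eqP => [[/orP[/eqP//|/eqP->] /induces_connected_neq0]|->].
  by rewrite eqxx.
by rewrite eqxx induces_connected1.
Qed.

Lemma card_splits r A B C : splits r A B C -> #|A| = #|B| + #|C|.
Proof.
case=> _ _ -> dBC _; rewrite cardsU.
by move: dBC; rewrite -setI_eq0 => /eqP->; rewrite cards0 subn0.
Qed.

Lemma splits_card_lt r A B C : splits r A B C ->
  [/\ 0 < #|B|, 0 < #|C|, #|B| < #|A| & #|C| < #|A|].
Proof.
move=> sBC; have := card_splits sBC; case: sBC => B0 C0 _ _ _.
by move: B0 C0; rewrite -!card_gt0 => ? ? ?; split; lia.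
Qed.

Lemma set_mean_bounds_union A B C : splits (negrel (@adj G)) A B C ->
  set_mean_bounds B -> set_mean_bounds C -> set_mean_bounds A.
Proof.
move=> sBC bB bC; rewrite /set_mean_bounds /nconn /wconn !(sum_conn_sets_union _ sBC).
by rewrite (card_splits sBC) expnD PoszM !PoszD; apply: mean_bounds_union.
Qed.

Lemma set_mean_bounds_join A B C : splits (@adj G) A B C ->
  set_mean_bounds B -> set_mean_bounds C ->
  [/\ set_mean_bounds A, #|A| * nconn A < 2 * wconn A
    & 2 * wconn A < #|A|.+1 * nconn A].
Proof.
move=> sBC bB bC; have cA := card_splits sBC.
have NE : ((nconn A)%:Z + ((2 ^ #|B|)%N%:Z + (2 ^ #|C|)%N%:Z)
    = (nconn B)%:Z + (nconn C)%:Z + ((2 ^ #|B|)%N%:Z * (2 ^ #|C|)%N%:Z + 1))%R.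
  have := sum_conn_sets_join (fun=> 1) sBC.
  rewrite -/(nconn A) -/(nconn B) -/(nconn C) !sum1_card !card_powerset cA expnD.
  by lia.
have WE : (2 * (wconn A)%:Z + (#|B|%:Z * (2 ^ #|B|)%N%:Z + #|C|%:Z * (2 ^ #|C|)%N%:Z)
    = 2 * ((wconn B)%:Z + (wconn C)%:Z)
      + (#|B|%:Z + #|C|%:Z) * ((2 ^ #|B|)%N%:Z * (2 ^ #|C|)%N%:Z))%R.
  have := sum_conn_sets_join (fun S => #|S|) sBC.
  rewrite -/(wconn A) -/(wconn B) -/(wconn C) cards0.
  have := sum_powerset_card A; have := sum_powerset_card B; have := sum_powerset_card C.
  by rewrite cA expnD; lia.
have [mA D0 DN] := mean_bounds_join bB bC NE WE.
move: D0 DN; rewrite -PoszD -cA => D0 DN; split; try lia.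
by rewrite /set_mean_bounds cA expnD PoszM PoszD.
Qed.

(** The induction runs over vertex subsets of one fixed graph, so the pieces of a split need no
    graph structure of their own. *)
Lemma cograph_set_mean_bounds A : cograph G -> 0 < #|A| -> set_mean_bounds A.
Proof.
move=> coG; have [n] := ubnP #|A|; elim: n A => // n IHn A leAn A_gt0.
have [A_gt1|A_le1] := ltnP 1 #|A|; last first.
  have /cards1P[x ->] : #|A| == 1 by rewrite eqn_leq A_le1.
  rewrite /set_mean_bounds /nconn /wconn !sum_conn_sets1 cards1.
  exact: mean_bounds1.
have [B [C sBC]] := P4_free_splits (@adj_sym G) (cograph_P4_free coG) A_gt1.
case: sBC => sBC; have [B0 C0 BA CA] := splits_card_lt sBC.
  by apply: (set_mean_bounds_union sBC); apply: IHn => //; lia.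
by case: (set_mean_bounds_join sBC) => //; apply: IHn => //; lia.
Qed.

(** By connectedness the top split is a join, where both bounds are strict. *)
Lemma connected_cograph_mean_bounds : graph_connected G -> cograph G ->
  1 < graph_order G ->
  graph_order G * nconn setT < 2 * wconn setT < (graph_order G).+1 * nconn setT.
Proof.
move=> conG coG; rewrite /graph_order -cardsT => G_gt1.
have [B [C sBC]] := P4_free_splits (@adj_sym G) (cograph_P4_free coG) G_gt1.
have conT := induces_connectedT conG.
case: sBC => sBC.
  have := induces_connected_union sBC (subxx _) conT.
  have [_ _] := splits_card_lt sBC; rewrite !ltnNge.
  by move=> /negP nB /negP nC /orP[] /subset_leq_card.
have [B0 C0 _ _] := splits_card_lt sBC.
by case: (set_mean_bounds_join sBC) => [||_ -> ->] //; apply: cograph_set_mean_bounds.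
Qed.

(** Double counting by size; [f] constant 1 serves the value of the polynomial at 1, and [f] the
    identity its derivative there. *)
Lemma sum_num_connected (f : nat -> nat) :
  \sum_(1 <= k < (graph_order G).+1) f k * num_connected G k =
    \sum_(S in conn_sets [set: G]) f #|S|.
Proof.
under eq_bigr => k _.
  rewrite /num_connected mulnC -sum_nat_const big_mkcond /=; over.
rewrite exchange_big [RHS]big_mkcond /=; apply: eq_bigr => S _.
rewrite inE subsetT /=.
have [conS|nconS] := boolP (induces_connected S); last first.
  by rewrite big1 // => k _; rewrite inE (negbTE nconS) andbF.
under eq_bigr => k _ do rewrite inE conS andbT eq_sym.
(* Connected sets are nonempty, so their sizes lie in the range starting at 1. *)
rewrite -big_mkcond /= big_nat1_eq card_gt0 induces_connected_neq0 //=.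
by rewrite ltnS max_card.
Qed.

Lemma connected_poly1 (R : nzRingType) :
  (connected_poly R G).[1]%R = (nconn setT)%:R%R.
Proof.
rewrite /nconn -(sum_num_connected (fun=> 1)) horner_sum natr_sum.
by apply: eq_bigr => k _; rewrite hornerZ hornerXn expr1n mulr1 mul1n.
Qed.

Lemma deriv_connected_poly1 (R : comNzRingType) :
  ((connected_poly R G)^`()).[1]%R = (wconn setT)%:R%R.
Proof.
rewrite /wconn -(sum_num_connected id) raddf_sum horner_sum natr_sum.
apply: eq_bigr => k _.
by rewrite /= derivZ derivXn hornerZ hornerMn hornerXn expr1n -natrM mulnC.
Qed.

Lemma nconn_gt0 : graph_connected G -> 0 < nconn setT.
Proof.
move=> conG; rewrite /nconn sum1_card; apply/card_gt0P; exists [set: G].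
by rewrite inE subxx induces_connectedT.
Qed.

End CographMean.

(** * Bounds on the global mean and density *)

Section GlobalMean.
Local Open Scope ring_scope.
Variables (R : realFieldType) (G : sgraph).
Hypotheses (conG : graph_connected G) (coG : cograph G).
Local Notation n := (graph_order G).

Lemma graph_order_gt0 : (0 < n)%N.
Proof. exact: vertex_gt0. Qed.

Lemma global_meanE :
  global_mean R G = (wconn [set: G])%:R / (nconn [set: G])%:R.
Proof. by rewrite /global_mean connected_poly1 deriv_connected_poly1. Qed.

Lemma global_mean_order1 : n = 1%N -> global_mean R G = 1.
Proof.
move=> n1; have /cards1P[x Tx] : #|[set: G]| == 1%N by rewrite cardsT; apply/eqP.
by rewrite global_meanE Tx /nconn /wconn !sum_conn_sets1 cards1 divr1.
Qed.

Lemma global_mean_order_gt1 : (1 < n)%N ->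
  n%:R / 2 < global_mean R G < (n%:R + 1) / 2.
Proof.
move=> n_gt1; have N0 : 0 < (nconn [set: G])%:R :> R by rewrite ltr0n nconn_gt0.
have /andP[lo hi] := connected_cograph_mean_bounds conG coG n_gt1.
rewrite global_meanE ltr_pdivlMr // ltr_pdivrMr //.
move: lo hi; rewrite -!(ltr_nat R) !natrM -[n.+1%:R]natr1 => lo hi.
by apply/andP; split; lra.
Qed.

Lemma global_mean_bounds :
  [/\ n%:R / 2 < global_mean R G, global_mean R G <= (n%:R + 1) / 2 &
      global_mean R G = (n%:R + 1) / 2 <-> n = 1%N].
Proof.
have [n_gt1|n_le1] := ltnP 1 n.
  have /andP[lo hi] := global_mean_order_gt1 n_gt1.
  split=> //; first exact: ltW.
  by split=> [M|n1]; [rewrite M ltxx in hi | rewrite n1 in n_gt1].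
have n1 : n = 1%N by apply/eqP; rewrite eqn_leq n_le1 graph_order_gt0.
by rewrite (global_mean_order1 n1) n1; split=> [||]; [lra|lra|split=> // _; lra].
Qed.

(** The mean bounds give a deviation of at most 1/(2n); the weaker 1/n suffices for the limit. *)
Lemma density_bounds : `|2^-1 - density R G| <= n%:R^-1.
Proof.
have n0 : 0 < n%:R :> R by rewrite ltr0n graph_order_gt0.
have [lo hi _] := global_mean_bounds.
have nV : n%:R * n%:R^-1 = 1 :> R by rewrite divff ?gt_eqF.
have nV0 : 0 < n%:R^-1 :> R by rewrite invr_gt0.
have {}lo : n%:R / 2 * n%:R^-1 < density R G by rewrite ltr_pM2r.
have {}hi : density R G <= (n%:R + 1) / 2 * n%:R^-1 by rewrite ler_pM2r.
by rewrite ler_norml; apply/andP; split; lra.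
Qed.

End GlobalMean.

(** * Finitely many isomorphism classes of bounded order *)

Section FinitelyManyGraphs.
Local Open Scope nat_scope.

(** Order and edge set after numbering the vertices by [enum_rank], in a finite type depending only
    on [K]. Orders up to [K] fit in ['I_K.+1], so [inord] loses nothing on them. *)
Definition graph_code K (G : sgraph) : 'I_K.+1 * {set 'I_K.+1 * 'I_K.+1} :=
  (inord (graph_order G),
   [set p : 'I_K.+1 * 'I_K.+1 | [exists x : G, exists y : G,
      [&& adj x y, enum_rank x == p.1 :> nat & enum_rank y == p.2 :> nat]]]).

Lemma graph_code_adj K (G : sgraph) (x y : G) : graph_order G <= K ->
  ((inord (enum_rank x), inord (enum_rank y)) \in (graph_code K G).2) = adj x y.
Proof.
move=> leGK; rewrite inE /=.
have rankK (z : G) : enum_rank z < K.+1.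
  by rewrite ltnS (leq_trans (ltnW (ltn_ord _)) leGK).
rewrite !inordK //; apply/existsP/idP => [[x' /existsP[y' /and3P[xy]]]|xy].
  by move=> /eqP/val_inj/enum_rank_inj <- /eqP/val_inj/enum_rank_inj <-.
by exists x; apply/existsP; exists y; rewrite xy !eqxx.
Qed.

Lemma graph_code_isomorphic K (G H : sgraph) :
  graph_order G <= K -> graph_order H <= K ->
  graph_code K G = graph_code K H -> isomorphic G H.
Proof.
move=> leGK leHK eq_code.
have eqn : #|G| = #|H|.
  by have /(congr1 val) := congr1 fst eq_code; rewrite /= !inordK.
(* The isomorphism matches vertices of equal rank. *)
pose f (x : G) : H := enum_val (cast_ord eqn (enum_rank x)).
pose g (y : H) : G := enum_val (cast_ord (esym eqn) (enum_rank y)).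
exists f; split.
  exists g => x; first by rewrite /f /g enum_valK cast_ordK enum_rankK.
  by rewrite /f /g enum_valK cast_ordKV enum_rankK.
move=> x y; rewrite -(graph_code_adj _ _ leGK) -(graph_code_adj _ _ leHK) eq_code.
by rewrite !enum_valK.
Qed.

End FinitelyManyGraphs.

(* Convergence of the densities *)
From mathcomp Require Import boolp classical_sets reals topology normedtype sequences.
Import numFieldNormedType.Exports.
Local Open Scope classical_set_scope.
Local Open Scope ring_scope.

(** Each value of [c] is taken by at most one index satisfying [P]; the maximum over [T] of bounds
    past these indices works. *)
Lemma eventually_avoid (T : finType) (c : nat -> T) (P : nat -> Prop) :
  (forall i j, P i -> P j -> c i = c j -> i = j) ->
  exists m, forall i, (m <= i)%N -> ~ P i.
Proof.
move=> c_inj.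
have [t|f f_gt] := @choice _ _ (fun t m => forall i, P i -> c i = t -> (i < m)%N).
  have [[i [Pi <-]]|noi] := pselect (exists i, P i /\ c i = t).
    by exists i.+1 => j Pj /(c_inj _ _ Pj Pi) ->.
  by exists 0%N => i Pi ci; case: noi; exists i.
exists (\max_t f t)%N => i le_i Pi.
by have := leq_trans (f_gt _ i Pi erefl) (leq_trans (leq_bigmax _) le_i); rewrite ltnn.
Qed.

Lemma graph_order_unbounded (G : nat -> sgraph) K :
  (forall i j : nat, i <> j -> ~ isomorphic (G i) (G j)) ->
  exists m, forall i, (m <= i)%N -> (K < graph_order (G i))%N.
Proof.
move=> noniso.
have [|m m_avoid] := @eventually_avoid _ (fun i => graph_code K (G i))
    (fun i => graph_order (G i) <= K)%N.
  move=> i j leiK lejK eq_code; apply: contrapT => /noniso; apply.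
  exact: graph_code_isomorphic leiK lejK eq_code.
by exists m => i /m_avoid/negP; rewrite -ltnNge.
Qed.

Theorem mainTheorem5 (R : realType) :
  (forall G : sgraph, graph_connected G -> cograph G ->
     [/\ (graph_order G)%:R / 2 < global_mean R G,
         global_mean R G <= ((graph_order G)%:R + 1) / 2 &
         global_mean R G = ((graph_order G)%:R + 1) / 2 <-> graph_order G = 1%N])
  /\
  (forall G : nat -> sgraph,
     (forall i : nat, graph_connected (G i)) ->
     (forall i : nat, cograph (G i)) ->
     (forall i j : nat, i <> j -> ~ isomorphic (G i) (G j)) ->
     (fun i : nat => density R (G i)) @ \oo --> (2^-1 : R)).
Proof.
split=> [G conG coG|G conG coG noniso]; first exact: global_mean_bounds.
apply/cvgrPdist_lt => e e0.
(* An order above this bound exceeds [e^-1], so its inverse is below [e]. *)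
have [m order_gt] := graph_order_unbounded (Num.bound e^-1) noniso.
exists m => // i /= le_mi.
apply: le_lt_trans (density_bounds R (conG i) (coG i)) _.
rewrite invf_plt ?posrE ?ltr0n ?graph_order_gt0 //.
apply: lt_trans (archi_boundP _) _; first by rewrite invr_ge0 ltW.
by rewrite ltr_nat order_gt.
Qed.
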